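(* Let $E,F$ be Banach spaces with $1$-unconditional bases $(e_i)_{i\in I}$, $(f_i)_{i\in I}$, respectively, indexed by the same set $I$. Let $(U_i)_{i\in I}$, $(V_i)_{i\in I}$ be families of Banach spaces and $A_i:U_i\to V_i$ bounded linear operators such that the map $e_i\mapsto\|A_i\|f_i$ extends linearly to a bounded operator $I_{E,F}:E\to F$. Let $A:U_E\to V_F$ be the operator $A(u_i)_{i\in I}=(A_iu_i)_{i\in I}$, and for $J\subset I$ let $A_J(u_i)_{i\in I}=(1_J(i)A_iu_i)_{i\in I}$. Then $$\mathbf{NP}_1(A,U_E,V_F)\leqslant\Bigl(\sup\bigl\{\mathbf{NP}_1(A_J,U_E,V_F):J\subset I,\ |J|<\infty\bigr\}\Bigr)\,\mathbf{NP}_1(I_{E,F},E,F).$$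
   Context: An unconditional basis $(e_i)_{i\in I}$ of $E$ is an unordered, not necessarily countable family such that each $x\in E$ has a unique representation $x=\sum a_ie_i$ with countably many nonzero coefficients and unconditional convergence; it is $1$-unconditional if $\|\sum \varepsilon_ia_ie_i\|\leqslant\|\sum a_ie_i\|$ whenever $|\varepsilon_i|\leqslant1$. For a family $(U_i)_{i\in I}$ of Banach spaces, $U_E=(\oplus U_i)_E=\{(u_i)_{i\in I}:u_i\in U_i,\ \sum_{i\in I}\|u_i\|e_i\in E\}$ with norm $\|(u_i)_{i\in I}\|=\|\sum_{i\in I}\|u_i\|e_i\|_E$; $V_F=(\oplus V_i)_F$ is defined similarly. A tree $T$ on a set is a set of finite sequences (the empty sequence allowed) closed under initial segments. $T'$ is $T$ minus its maximal members; $T^0=T$, $T^{\xi+1}=(T^\xi)'$, $T^\xi=\bigcap_{\zeta<\xi}T^\zeta$ for limit $\xi$; $o(T)$ is the least ordinal $\xi$ with $T^\xi=\varnothing$, or $\infty$ if there is none; $\xi<\infty$ and $\xi\infty=\infty\xi=\infty$ for every ordinal $\xi$ (and $\infty\infty=\infty$). Products of ordinals are ordinal products. For an operator $A:X\to Y$ and $K\geqslant1$, $T_1(A,X,Y,K)$ is the tree of all finite sequences $(x_i)_{i=1}^n$ in the closed unit ball $B_X$ such that for all scalars $\|\sum_{i=1}^na_ix_i\|\leqslant\sum_{i=1}^n|a_i|$ and $\sum_{i=1}^n|a_i|\leqslant K\|\sum_{i=1}^na_iAx_i\|$. Put $\mathbf{NP}_1(A,X,Y)=\sup_{K\geqslant1}o(T_1(A,X,Y,K))$.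 *)

(* Defs.v *)
From HB Require Import structures.
From mathcomp Require Import all_boot all_order all_algebra.
From mathcomp Require Import finmap complex.
From mathcomp Require Import all_classical all_reals topology normedtype.
From mathcomp Require Import numfun summability.

Set Implicit Arguments.
Unset Strict Implicit.
Unset Printing Implicit Defensive.

Import Order.TTheory GRing.Theory Num.Theory.
Import numFieldNormedType.Exports.

Local Open Scope classical_set_scope.
Local Open Scope ring_scope.

#[export] Existing Instance totally_filter.

(* Ordinals as well-founded terms: every (small) ordinal is denoted by some
   term, possibly by several, so ordinals are compared with [ord_le] and
   equality of ordinals is [ord_le] both ways, never [=].
   [OSup t0 f] denotes the supremum of the family [f], whose index type is
   inhabited by [t0]; limit ordinals are of this form. A supremum need not be
   a limit, but the limit clauses of the recursive definitions below are also
   correct for suprema of arbitrary nonempty families. *)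
Inductive ordnum : Type :=
| OZero
| OSucc (a : ordnum)
| OSup (T : Type) (t0 : T) (f : T -> ordnum).

(* [a + 1 <= b] iff [a < b], where [a < b + 1] iff [a <= b], and [a < sup f]
   iff [a < f t] for some [t]. *)
Fixpoint ord_le (a : ordnum) : ordnum -> Prop :=
  match a with
  | OZero => fun=> True
  | OSucc a' =>
      fix lt_a' (b : ordnum) : Prop :=
        match b with
        | OZero => False
        | OSucc b' => ord_le a' b'
        | OSup _ _ f => exists t, lt_a' (f t)
        end
  | OSup _ _ f => fun b => forall t, ord_le (f t) b
  end.

Fixpoint ord_add (a b : ordnum) : ordnum :=
  match b with
  | OZero => a
  | OSucc b' => OSucc (ord_add a b')
  | OSup _ t0 f => OSup t0 (fun t => ord_add a (f t))
  end.

Fixpoint ord_mul (a b : ordnum) : ordnum :=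
  match b with
  | OZero => OZero
  | OSucc b' => ord_add (ord_mul a b') a
  | OSup _ t0 f => OSup t0 (fun t => ord_mul a (f t))
  end.

Variant xordnum : Type := XFin of ordnum | XInfty.

Definition xord_le (a b : xordnum) : Prop :=
  match a, b with
  | _, XInfty => True
  | XInfty, XFin _ => False
  | XFin a', XFin b' => ord_le a' b'
  end.

Definition xord_mul (a b : xordnum) : xordnum :=
  match a, b with
  | XFin a', XFin b' => XFin (ord_mul a' b')
  | _, _ => XInfty
  end.

Definition xord_sup (T : Type) (t0 : T) (f : T -> xordnum) : xordnum :=
  if pselect (exists t, f t = XInfty) then XInfty
  else XFin (OSup t0 (fun t => if f t is XFin a then a else OZero)).

Definition tree_derivative (X : Type) (T : set (seq X)) : set (seq X) :=
  [set s | T s /\ exists2 t, t <> [::] & T (s ++ t)].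

Fixpoint tree_derived (X : Type) (T : set (seq X)) (a : ordnum) : set (seq X) :=
  match a with
  | OZero => T
  | OSucc a' => tree_derivative (tree_derived T a')
  | OSup _ _ f => [set s | forall t, tree_derived T (f t) s]
  end.

Definition is_tree_order (X : Type) (T : set (seq X)) (a : ordnum) : Prop :=
  tree_derived T a = set0 /\
  forall b, tree_derived T b = set0 -> ord_le a b.

Definition tree_order (X : Type) (T : set (seq X)) : xordnum :=
  if pselect (exists a, is_tree_order T a) is left h then XFin (projT1 (cid h))
  else XInfty.

Definition is_tree (X : Type) (T : set (seq X)) : Prop :=
  forall s t, T (s ++ t) -> T s.

Lemma is_tree_derived (X : Type) (T : set (seq X)) a :
  is_tree T -> is_tree (tree_derived T a).
Proof.
move=> Ttree; elim: a => [//|a IH s t /= [st [w w0 stw]]|S t0 f IH s t /= st k].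
- split; first exact: IH st.
  exists (t ++ w); last by rewrite catA.
  by case: (t) w0 => //; case: (w).
- exact: IH (st k).
Qed.

(* [ordnum] contains enough ordinals: a tree without infinite branch never
   gets order [XInfty] for lack of small ordinals. *)
Lemma tree_derived_eq0 (X : Type) (T : set (seq X)) : is_tree T ->
  ~ (exists x : nat -> X, forall n, T (mkseq x n)) ->
  exists a, tree_derived T a = set0.
Proof.
move=> Ttree nobranch; apply: contrapT => nota.
have step s : (exists a, ~ tree_derived T a s) \/
    (exists x, ~ exists a, ~ tree_derived T a (rcons s x)).
  have [[x hx]|H] := pselect (exists x, ~ exists a, ~ tree_derived T a (rcons s x)).
    by right; exists x.
  have {}H x : exists a, ~ tree_derived T a (rcons s x).
    by apply: contrapT => nx; apply: H; exists x.
  left; have [[x0 _]|X0] := pselect (exists x : X, True); last first.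
    exists (OSucc OZero) => /= -[_ [[|x t]// _ _]]; by apply: X0; exists x.
  have [g Hg] := choice H.
  exists (OSucc (OSup x0 g)) => /= -[_ [[|x t]// _ sxt]].
  apply: (Hg x); apply: (@is_tree_derived _ _ _ Ttree _ t).
  by rewrite cat_rcons; exact: sxt.
have {}step (s : {s | forall a, tree_derived T a s}) :
    exists x, forall a, tree_derived T a (rcons (sval s) x).
  case: (step (sval s)) => [[a]|[x nx]]; first by have := svalP s a.
  exists x => a; apply: contrapT => na; by apply: nx; exists a.
have [g Hg] := choice step.
have root a : tree_derived T a [::].
  apply: contrapT => na; apply: nota; exists a; rewrite -subset0 => s sa.
  by apply: na; apply: (@is_tree_derived _ _ _ Ttree _ s).
pose next s : {s | forall a, tree_derived T a s} := exist _ _ (Hg s).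
pose branch n := iter n next (exist _ [::] root).
apply: nobranch; exists (fun n => g (branch n)) => n.
have -> : mkseq (fun n => g (branch n)) n = sval (branch n).
  by elim: n => [//|n IH]; rewrite mkseqS IH.
exact: (svalP (branch n) OZero).
Qed.

Variant scalar_field (R : realType) : numFieldType -> Prop :=
| RealScalars : scalar_field R R
| ComplexScalars : scalar_field R R[i].

(* Norms take their values in the scalar field [K] itself, on its nonnegative
   part when [K] is the field of complex numbers. *)

Definition opnorm (K : numFieldType) (X Y : normedModType K)
    (A : {linear X -> Y}) : K :=
  supremum 0 [set `|A x| | x in [set x : X | `|x| <= 1]].

Definition T1 (K : numFieldType) (X Y : normedModType K)
    (A : {linear X -> Y}) (c : K) : set (seq X) :=
  [set x | all (fun v => `|v| <= 1) x /\
     forall a : nat -> K,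
       `|\sum_(i < size x) a i *: x`_i| <= \sum_(i < size x) `|a i| /\
       \sum_(i < size x) `|a i| <= c * `|\sum_(i < size x) a i *: A x`_i| ].

Lemma T1_is_tree (K : numFieldType) (X Y : normedModType K)
  (A : {linear X -> Y}) (c : K) : is_tree (T1 A c).
Proof.
move=> s t [st1 stP]; split; first by move: st1; rewrite all_cat => /andP[].
move=> a; pose b i := if (i < size s)%N then a i else 0.
have sumE (V : zmodType) (g h : nat -> V) :
    (forall i, (i < size s)%N -> g i = h i) ->
    (forall i, (size s <= i)%N -> g i = 0) ->
    \sum_(i < size (s ++ t)) g i = \sum_(i < size s) h i.
  move=> gh g0; rewrite -(big_mkord xpredT g) size_cat.
  rewrite (big_cat_nat (leq0n _) (leq_addr _ _)) /=.
  have -> : \sum_(size s <= i < size s + size t) g i = 0.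
    by rewrite big_nat big1 // => i /andP[si _]; exact: g0.
  by rewrite addr0 big_mkord; apply: eq_bigr => i _; exact: gh.
have b0 i : (size s <= i)%N -> b i = 0 by move=> si; rewrite /b ltnNge si.
have := stP b.
have -> : \sum_(i < size (s ++ t)) b i *: (s ++ t)`_i =
    \sum_(i < size s) a i *: s`_i.
  apply: (sumE _ (fun i => b i *: (s ++ t)`_i) (fun i => a i *: s`_i)) => i si.
    by rewrite /b si nth_cat si.
  by rewrite b0 // scale0r.
have -> : \sum_(i < size (s ++ t)) b i *: A (s ++ t)`_i =
    \sum_(i < size s) a i *: A s`_i.
  apply: (sumE _ (fun i => b i *: A (s ++ t)`_i) (fun i => a i *: A s`_i)) => i si.
    by rewrite /b si nth_cat si.
  by rewrite b0 // scale0r.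
have -> // : \sum_(i < size (s ++ t)) `|b i| = \sum_(i < size s) `|a i|.
apply: (sumE _ (fun i => `|b i|) (fun i => `|a i|)) => i si.
  by rewrite /b si.
by rewrite b0 // normr0.
Qed.

Corollary T1_derived_eq0 (K : numFieldType) (X Y : normedModType K)
    (A : {linear X -> Y}) (c : K) :
  ~ (exists x : nat -> X, forall n, T1 A c (mkseq x n)) ->
  exists a, tree_derived (T1 A c) a = set0.
Proof. exact/tree_derived_eq0/T1_is_tree. Qed.

Definition NP1 (K : numFieldType) (X Y : normedModType K)
    (A : {linear X -> Y}) : xordnum :=
  xord_sup (exist (fun c : K => 1 <= c) 1 (lexx 1))
    (fun c => tree_order (T1 A (sval c))).

Section Basis.
Variables (K : numFieldType) (I : choiceType).

(* Unconditional convergence of an unordered series: the net of partial sums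
   over the finite subsets of [I] converges. *)
Definition sums_to (E : normedModType K) (x : I -> E) (l : E) : Prop :=
  partial_sum x @ totally --> l.

Definition unconditional_basis (E : normedModType K) (e : I -> E) : Prop :=
  forall x : E, exists! a : I -> K,
    countable [set i | a i != 0] /\ sums_to (fun i => a i *: e i) x.

(* In a Banach space the convergence of the second series is automatic, see
   [dominated_cvg]. *)
Definition one_unconditional (E : normedModType K) (e : I -> E) : Prop :=
  forall (a eps : I -> K) (x y : E), (forall i, `|eps i| <= 1) ->
    sums_to (fun i => a i *: e i) x ->
    sums_to (fun i => (eps i * a i) *: e i) y -> `|y| <= `|x|.

Record unc1_basis (E : normedModType K) := Unc1Basis {
  basis_vec :> I -> E;
  basis_repr : unconditional_basis basis_vec;
  basis_unc1 : one_unconditional basis_vec }.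

End Basis.

Section BasisTheory.
Variables (K : numFieldType) (I : choiceType) (E : completeNormedModType K).
Variable e : unc1_basis I E.
Implicit Types (a b : I -> K) (S : {fset I}).

Let ps a S := \sum_(i <- S) a i *: e i.

Lemma partial_sumE (V : zmodType) (x : I -> V) S :
  partial_sum x S = \sum_(i <- S) x i.
Proof. by rewrite /partial_sum big_seq_fsetE. Qed.

Lemma sums_finite a S : (forall i, i \notin S -> a i = 0) ->
  sums_to (fun i => a i *: e i) (ps a S).
Proof.
move=> aS; apply: cvg_near_cst; exists S => // B /= SB.
rewrite partial_sumE /ps; apply/eqP.
rewrite (big_fset_incl _ SB) ?eqxx // => i _ iS.
by rewrite aS // scale0r.
Qed.

Lemma dominated_le a b x y : (forall i, `|a i| <= `|b i|) ->
  sums_to (fun i => b i *: e i) x ->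
  sums_to (fun i => a i *: e i) y -> `|y| <= `|x|.
Proof.
move=> ab bx ay.
have epsab i : a i / b i * b i = a i.
  have [b0|b0] := eqVneq (b i) 0; last by rewrite divfK.
  have := ab i; rewrite b0 normr0 normr_le0 => /eqP ->.
  by rewrite mulr0.
apply: (@basis_unc1 _ _ _ e b (fun i => a i / b i) x y) => //.
- move=> i; rewrite normrM normfV.
  have [->|b0] := eqVneq (b i) 0; first by rewrite normr0 invr0 mulr0 ler01.
  by rewrite ler_pdivrMr ?normr_gt0 // mul1r.
- by under eq_fun do rewrite epsab.
Qed.

Lemma dominated_ps_le a b S : (forall i, `|a i| <= `|b i|) ->
  `|ps a S| <= `|ps b S|.
Proof.
move=> ab; pose r (c : I -> K) i := if i \in S then c i else 0.
have psr c : ps c S = ps (r c) S.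
  by rewrite /ps; apply: eq_big_seq => i iS; rewrite /r iS.
have rS c : sums_to (fun i => r c i *: e i) (ps (r c) S).
  by apply: sums_finite => i /negbTE iS; rewrite /r iS.
rewrite (psr a) (psr b); apply: (@dominated_le (r a) (r b)) => // i.
by rewrite /r; case: ifP.
Qed.

Lemma dominated_cvg a b : (forall i, `|a i| <= `|b i|) ->
  cvg (partial_sum (fun i => b i *: e i) @ totally) ->
  cvg (partial_sum (fun i => a i *: e i) @ totally).
Proof.
move=> ab /cvg_ex[x bx]; apply: cauchy_cvg; apply: cauchy_exP => d d0.
have d20 : 0 < d / 2 by rewrite divr_gt0.
have /cvgrPdist_lt/(_ _ d20)[S0 _ HS0] := bx.
exists (ps a S0), S0 => // S /= S0S.
rewrite -ball_normE /= partial_sumE -/(ps a S).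
have split c : ps c S = ps c S0 + ps c (S `\` S0)%fset.
  rewrite /ps [LHS](big_fsetID _ (mem S0)) /=.
  congr (_ + _); apply: eq_fbigl => i; rewrite !inE /=; last by rewrite andbC.
  by apply/andP/idP => [[]|iS0] //; split=> //; exact: (fsubsetP S0S).
rewrite split opprD addNKr normrN (le_lt_trans (dominated_ps_le _ ab)) //.
have -> : ps b (S `\` S0)%fset = (x - ps b S0) - (x - ps b S).
  by rewrite split opprB addrC addrA subrK addrC addKr.
rewrite (le_lt_trans (ler_normB _ _)) // [d]splitr ltrD //.
  by have := HS0 S0; rewrite /= partial_sumE; apply.
by have := HS0 S; rewrite /= partial_sumE; apply.
Qed.

Lemma basis_neq0 i : e i != 0.
Proof.
apply/eqP => ei0.
have [a [_ au]] := basis_repr e 0.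
have A0 : a = fun=> 0.
  apply: au; split.
    by apply: (@sub_countable _ _ _ set0) => //; apply: subset_card_le => j /eqP.
  have := @sums_finite (fun=> 0) fset0; rewrite /ps big_seq_fset0; exact.
have A1 : a = fun j => (j == i)%:R.
  apply: au; split.
    apply: (@sub_countable _ _ _ [set i]); last exact: countable1.
    apply: subset_card_le => j /=.
    by case: (eqVneq j i) => [->|_] //; rewrite eqxx.
  have := @sums_finite (fun j => (j == i)%:R) [fset i]%fset.
  rewrite /ps big_seq_fset1 ei0 scaler0; apply => j.
  by rewrite inE => /negbTE ->.
by move: A1; rewrite A0 => /(congr1 (@^~ i))/eqP; rewrite eqxx eq_sym oner_eq0.
Qed.

Lemma coef_le a x i : sums_to (fun i => a i *: e i) x -> `|a i| * `|e i| <= `|x|.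
Proof.
move=> ax; rewrite -normrZ.
have := @sums_finite (fun j => if j == i then a i else 0) [fset i]%fset.
rewrite /ps big_seq_fset1 eqxx => H; apply: (dominated_le _ ax (H _)).
  by move=> j; case: eqP => [->|] //; rewrite normr0.
by move=> j; rewrite inE => /negbTE ->.
Qed.

End BasisTheory.

Section DirectSum.
Variables (K : numFieldType) (I : choiceType) (E : completeNormedModType K).
Variables (e : unc1_basis I E) (U : I -> completeNormedModType K).

(* [dsum] is the space U_E: the sum of the |u_i| e_i converges in [E], and its
   norm is the norm of [u], see [dsum_normE]. *)
Definition in_dsum (u : forall i, U i) : Prop :=
  cvg (partial_sum (fun i => `|u i| *: e i) @ totally).

Record dsum := DSum { dsum_val :> forall i, U i; dsumP : in_dsum dsum_val }.

Arguments dsumP : clear implicits.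

Lemma dsum_ext (u v : dsum) : (forall i, u i = v i) -> u = v.
Proof.
case: u v => [u hu] [v hv] /= uv.
have {}uv : u = v by exact: functional_extensionality_dep.
by subst v; congr DSum; exact: Prop_irrelevance.
Qed.

HB.instance Definition _ := gen_eqMixin dsum.
HB.instance Definition _ := gen_choiceMixin dsum.

Lemma in_dsum_le (u : forall i, U i) (b : I -> K) :
  (forall i, `|u i| <= b i) ->
  cvg (partial_sum (fun i => b i *: e i) @ totally) -> in_dsum u.
Proof.
move=> ub; apply: dominated_cvg => i.
by rewrite normr_id (ger0_norm (le_trans (normr_ge0 _) (ub i))).
Qed.

Lemma sums_toD (x y : I -> E) l m : sums_to x l -> sums_to y m ->
  sums_to (fun i => x i + y i) (l + m).
Proof.
move=> xl ym; rewrite /sums_to.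
rewrite (_ : partial_sum _ = partial_sum x \+ partial_sum y); first exact: cvgD.
by apply/funext => S; rewrite /partial_sum /= -big_split.
Qed.

Lemma sums_toZ (c : K) (x : I -> E) l : sums_to x l ->
  sums_to (fun i => c *: x i) (c *: l).
Proof.
move=> xl; rewrite /sums_to.
rewrite (_ : partial_sum _ = fun S => c *: partial_sum x S); first exact: cvgZr.
by apply/funext => S; rewrite /partial_sum /= scaler_sumr.
Qed.

Lemma in_dsum0 : in_dsum (fun=> 0).
Proof.
apply/cvg_ex; exists 0; apply: cvg_near_cst; near=> S.
by rewrite /partial_sum big1 // => i _; rewrite normr0 scale0r.
Unshelve. all: by end_near. Qed.

Lemma in_dsumN (u : dsum) : in_dsum (fun i => - u i).
Proof. by rewrite /in_dsum; under eq_fun do rewrite normrN; exact: dsumP. Qed.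

Lemma in_dsumD (u v : dsum) : in_dsum (fun i => u i + v i).
Proof.
apply: (@in_dsum_le _ (fun i => `|u i| + `|v i|)); first by move=> i; exact: ler_normD.
have /cvg_ex[x ux] := dsumP u; have /cvg_ex[y vy] := dsumP v.
apply/cvg_ex; exists (x + y); under eq_fun do rewrite scalerDl.
exact: sums_toD.
Qed.

Lemma in_dsumZ (c : K) (u : dsum) : in_dsum (fun i => c *: u i).
Proof.
have /cvg_ex[x ux] := dsumP u; apply/cvg_ex; exists (`|c| *: x).
under eq_fun do rewrite normrZ -scalerA.
exact: sums_toZ.
Qed.

Arguments in_dsumN : clear implicits.
Arguments in_dsumD : clear implicits.
Arguments in_dsumZ : clear implicits.

Definition dsum_add (u v : dsum) : dsum := DSum (in_dsumD u v).
Definition dsum_opp (u : dsum) : dsum := DSum (in_dsumN u).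
Definition dsum_zero : dsum := DSum in_dsum0.

Lemma dsum_addA : associative dsum_add.
Proof. by move=> u v w; apply: dsum_ext => i /=; rewrite addrA. Qed.

Lemma dsum_addC : commutative dsum_add.
Proof. by move=> u v; apply: dsum_ext => i /=; rewrite addrC. Qed.

Lemma dsum_add0 : left_id dsum_zero dsum_add.
Proof. by move=> u; apply: dsum_ext => i /=; rewrite add0r. Qed.

Lemma dsum_addN : left_inverse dsum_zero dsum_opp dsum_add.
Proof. by move=> u; apply: dsum_ext => i /=; rewrite addNr. Qed.

HB.instance Definition _ :=
  GRing.isZmodule.Build dsum dsum_addA dsum_addC dsum_add0 dsum_addN.

Definition dsum_scale (c : K) (u : dsum) : dsum := DSum (in_dsumZ c u).

Lemma dsum_scaleA a b u : dsum_scale a (dsum_scale b u) = dsum_scale (a * b) u.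
Proof. by apply: dsum_ext => i /=; rewrite scalerA. Qed.

Lemma dsum_scale1 : left_id 1 dsum_scale.
Proof. by move=> u; apply: dsum_ext => i /=; rewrite scale1r. Qed.

Lemma dsum_scaleDr : right_distributive dsum_scale +%R.
Proof. by move=> c u v; apply: dsum_ext => i /=; rewrite scalerDr. Qed.

Lemma dsum_scaleDl u : {morph dsum_scale^~ u : a b / a + b}.
Proof. by move=> a b; apply: dsum_ext => i /=; rewrite scalerDl. Qed.

HB.instance Definition _ :=
  GRing.Zmodule_isLmodule.Build K dsum
    dsum_scaleA dsum_scale1 dsum_scaleDr dsum_scaleDl.

Definition dsum_norm (u : dsum) : K :=
  `|lim (partial_sum (fun i => `|u i| *: e i) @ totally)|.

Lemma dsum_sums (u : dsum) : sums_to (fun i => `|u i| *: e i)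
  (lim (partial_sum (fun i => `|u i| *: e i) @ totally)).
Proof. exact: dsumP u. Qed.

Arguments dsum_sums : clear implicits.

Lemma dsum_ler_normD (u v : dsum) :
  dsum_norm (u + v) <= dsum_norm u + dsum_norm v.
Proof.
apply: le_trans (ler_normD _ _).
have := sums_toD (dsum_sums u) (dsum_sums v).
rewrite (_ : (fun i => _) = fun i => (`|u i| + `|v i|) *: e i); last first.
  by apply/funext => i; rewrite scalerDl.
move/dominated_le; apply; last exact: dsum_sums.
by move=> i; rewrite normr_id ger0_norm ?addr_ge0 //; exact: ler_normD.
Qed.

Lemma dsum_normZ (c : K) (u : dsum) : dsum_norm (c *: u) = `|c| * dsum_norm u.
Proof.
rewrite /dsum_norm -(normr_id c) -normrZ; congr (Num.norm _).
apply/cvg_lim => //; have := sums_toZ (c := `|c|) (dsum_sums u).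
rewrite (_ : (fun i => _) = fun i => `|(c *: u : dsum) i| *: e i) //.
by apply/funext => i; rewrite scalerA -normrZ.
Qed.

Lemma dsum_norm_eq0 (u : dsum) : dsum_norm u = 0 -> u = 0.
Proof.
move=> u0; apply: dsum_ext => i; apply/eqP; rewrite -normr_eq0.
have := coef_le i (dsum_sums u); rewrite -/(dsum_norm u) u0 normr_id.
rewrite pmulr_lle0 ?normr_gt0 ?basis_neq0 // => ui.
by rewrite eq_le ui normr_ge0.
Qed.

HB.instance Definition _ :=
  Lmodule_isNormed.Build K dsum dsum_ler_normD dsum_normZ dsum_norm_eq0.

Lemma dsum_normE (u : dsum) :
  `|u| = `|lim (partial_sum (fun i => `|u i| *: e i) @ totally)|.
Proof. by []. Qed.

End DirectSum.
Arguments dsumP {K I E e U}.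

Lemma scalar_supremum (R : realType) (K : numFieldType) (S : set K) :
  scalar_field R K -> S !=set0 -> (forall x, S x -> 0 <= x) ->
  has_ubound S -> supremums S !=set0.
Proof.
move=> hK; case: K / hK S => S S0 S_ge0 [M SM].
  exists (sup S); split=> [x Sx|y Sy]; last exact: ge_sup.
  by apply: ub_le_sup => //; exists M.
pose S' : set R := [set complex.Re x | x in S].
have SRe x : S x -> x = (complex.Re x)%:C%C.
  by move/S_ge0; case: x => a b; rewrite lecE /= => /andP[/eqP -> _].
have S'M y : ubound S y -> ubound S' (complex.Re y).
  by move=> Sy _ [x Sx <-]; have := Sy x Sx; rewrite lecE => /andP[].
exists ((sup S')%:C%C); split=> [x Sx|y Sy].
  rewrite (SRe _ Sx) lecR; apply: ub_le_sup; last by exists x.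
  by exists (complex.Re M); exact: S'M.
case: S0 => x Sx; have := Sy x Sx; rewrite (SRe _ Sx) !lecE /= => /andP[-> _].
by apply: ge_sup; [exists (complex.Re x), x | exact: S'M].
Qed.

Lemma opnorm_le (R : realType) (K : numFieldType) (X Y : normedModType K)
    (A : {linear X -> Y}) (x : X) :
  scalar_field R K -> bounded_near A (nbhs 0) -> `|A x| <= opnorm A * `|x|.
Proof.
move=> hK /linear_boundedP/pinfty_ex_gt0[r r0 Ar].
have [->|x0] := eqVneq x 0; first by rewrite linear0 !normr0 mulr0.
have nx0 : `|x| != 0 by rewrite normr_eq0.
rewrite /opnorm; set S := [set _ | _ in _].
have Sx : S (`|A x| / `|x|).
  exists (`|x|^-1 *: x); first by rewrite /= normrZ normfV normr_id mulVf.
  by rewrite linearZ normrZ normfV normr_id mulrC.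
have : supremums S !=set0.
  apply: (scalar_supremum hK); first by eexists; exact: Sx.
    by move=> _ [y _ <-].
  exists r => _ [y /= y1 <-]; rewrite (le_trans (Ar y)) //.
  by rewrite -[leRHS]mulr1 ler_wpM2l // ltW.
rewrite /supremum; case: ifPn => [/eqP S0|_]; first by rewrite S0 in Sx.
case: xgetP => [s _ [Ss _] _|nS [s /nS]] //.
by rewrite -ler_pdivrMr ?normr_gt0 //; exact: Ss.
Qed.

Section Diagonal.
Variables (K : numFieldType) (I : choiceType) (E F : completeNormedModType K).
Variables (e : unc1_basis I E) (f : unc1_basis I F).
Variables (U V : I -> completeNormedModType K).

(* [dsum_op] is the diagonal operator (u_i) |-> (A_i u_i) from U_E to V_F. *)
Definition maps_dsum (A : forall i, {linear U i -> V i}) : Prop :=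
  forall u : dsum e U, in_dsum f (fun i => A i (u i)).

Definition dsum_op (A : forall i, {linear U i -> V i}) (hA : maps_dsum A)
  (u : dsum e U) : dsum f V := DSum (hA u).

Lemma dsum_op_linear A (hA : maps_dsum A) : linear (dsum_op hA).
Proof. by move=> c u v; apply: dsum_ext => i /=; rewrite linearP. Qed.

HB.instance Definition _ A (hA : maps_dsum A) :=
  GRing.isLinear.Build K (dsum e U) (dsum f V) *:%R (dsum_op hA)
    (dsum_op_linear hA).

Definition restrict_family (J : set I) (A : forall i, {linear U i -> V i}) :
  forall i, {linear U i -> V i} := fun i => \1_J i \*: A i.

Lemma maps_dsum_restrict (J : set I) A :
  maps_dsum A -> maps_dsum (restrict_family J A).
Proof.
move=> hA u; apply: (in_dsum_le (b := fun i => `|A i (u i)|)); last exact: hA.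
move=> i /=; rewrite normrZ indicE; case: (_ \in _).
  by rewrite normr1 mul1r.
by rewrite normr0 mul0r.
Qed.

Lemma maps_dsumP (R : realType) (A : forall i, {linear U i -> V i})
    (T : {linear E -> F}) :
  scalar_field R K -> (forall i, bounded_near (A i) (nbhs 0)) ->
  bounded_near T (nbhs 0) -> (forall i, T (e i) = opnorm (A i) *: f i) ->
  maps_dsum A.
Proof.
move=> hK bA /bounded_linear_continuous cT Te u.
apply: (in_dsum_le (b := fun i => opnorm (A i) * `|u i|)).
  by move=> i; exact: opnorm_le hK (bA i).
have /cvg_ex[x ux] := dsumP u; apply/cvg_ex; exists (T x).
rewrite (_ : partial_sum _ = T \o partial_sum (fun i => `|u i| *: e i)).
  by apply: continuous_cvg; [exact: cT|exact: ux].
apply/funext => S; rewrite /partial_sum /= linear_sum.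
by apply: eq_bigr => i _; rewrite linearZ /= Te scalerA mulrC.
Qed.

End Diagonal.
Arguments maps_dsum_restrict {K I E F e f U V} J {A} hA.

(* Main.v *)
Require Import Defs.
From mathcomp Require Import all_boot all_order all_algebra.
From mathcomp Require Import finmap.
From mathcomp Require Import all_classical all_reals topology normedtype.
From mathcomp Require Import numfun summability.

Set Implicit Arguments.
Unset Strict Implicit.
Unset Printing Implicit Defensive.

Import Order.TTheory GRing.Theory Num.Theory.
Import numFieldNormedType.Exports.

Local Open Scope classical_set_scope.
Local Open Scope ring_scope.

(** Let b be the supremum of the indices of the operators A_J over finite J, and
    g the index of I_EF; both may be assumed to be ordinals. It has to be shown
    that, for each c >= 1, the derived tree of order b * g of T1(A, c) is empty.

    Since T1(A_J, d) has order at most b for every d, a sequence that survives b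
    derivations in a subtree of T1(A, c) can be continued inside that subtree by
    some t carrying a combination x of t, normalized in l1, with A_J x as small
    as desired: otherwise the continuations would form a subtree of some
    T1(A_J, d) of order more than b ([small_combination]). Take for J the finite
    set used by the combinations found so far. As A x is moreover concentrated up
    to a small error on a finite set, it is nearly supported by a finite set B
    disjoint from all the previous ones ([blocks_extend]). Thus each batch of b
    derivations yields one more almost disjoint block (x, B).

    To the blocks (x_k, B_k) correspond the vectors z_k, the sum of |x_k(i)| e_i
    over i in B_k, in the unit ball of E. Because the B_k are disjoint and
    |A_i x_k(i)| <= |A_i| |x_k(i)|, 1-unconditionality of the basis of F bounds
    the norm of the sum of the a_k A x_k by that of the sum of the a_k I_EF z_k,
    up to an error eps * sum |a_k| ([block_le]); with eps = 1/(2c), the lower l1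
    estimate of A with constant c becomes one of I_EF with constant 2c
    ([block_vectors_T1]). The errors are weighted by the |a_k|, whose sum is what
    is being estimated, which is why the same eps serves for all blocks.

    By induction on xi, if s survives b * xi derivations in T1(A, c) then the z_k
    of its blocks survive xi derivations in T1(I_EF, 2c) ([block_tree]). For
    xi = g and s empty this contradicts the choice of g. *)

(** * Ordinals *)

Lemma ord_le_refl a : ord_le a a.
Proof.
have le_sup (c : ordnum) T (t0 : T) f t : ord_le c (f t) -> ord_le c (OSup t0 f).
  elim: c => [//|c _ ctf|U u0 g IH gf u]; first by exists t.
  exact: IH (gf u).
elim: a => [//|a IH|T t0 f IH t]; first exact: IH.
exact: le_sup (IH t).
Qed.

Lemma ord_le_trans b a c : ord_le a b -> ord_le b c -> ord_le a c.
Proof.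
elim: a b c => [//|a IHa|T t0 f IH] b c; last by move=> fb bc t; exact: IH (fb t) bc.
elim: b c => [//|b _|T t0 f IH] c.
  elim: c => [//|c _|T t0 f IH] /=; first exact: IHa.
  by move=> ab [t bt]; exists t; exact: IH.
by move=> [t at_] fc; exact: IH at_ (fc t).
Qed.

Lemma ord_le_total a b : ord_le a b \/ ord_le (OSucc b) a.
Proof.
elim: a b => [b|a IHa|T t0 f IH] /=; first by left.
  elim=> [|b _|T t0 f IH]; [by right|exact: IHa|].
  have [[t at_]|nat_] := pselect (exists t, ord_le (OSucc a) (f t)).
    by left; exists t.
  by right=> t; case: (IH t) => // at_; case: nat_; exists t.
move=> b; have [fb|] := pselect (forall t, ord_le (f t) b); first by left.
by move=> /existsNP[t nfb]; right; exists t; case: (IH t b).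
Qed.

(** Well-foundedness: by totality, if [P] had no least element, then below each
    ordinal satisfying [P] there would be a strictly smaller one. *)
Lemma ord_least (P : ordnum -> Prop) a : P a ->
  exists2 b, P b & forall c, P c -> ord_le b c.
Proof.
move=> Pa; apply: contrapT => nomin.
have below b : P b -> exists2 c, P c & ord_le (OSucc c) b.
  move=> Pb; apply: contrapT => nc; apply: nomin; exists b => // c Pc.
  by case: (ord_le_total b c) => // cb; case: nc; exists c.
suff none c b : ord_le (OSucc b) c -> ~ P b by exact: none (ord_le_refl (OSucc a)) Pa.
elim: c b => [//|c IH|T t0 f IH] b /= => [bc /below[d Pd db]|[t bt]].
  exact: IH (ord_le_trans db bc) Pd.
exact: IH bt.
Qed.

(** * Derived trees and their orders *)

Section Trees.
Variable X : Type.
Implicit Types (S T : set (seq X)) (s t : seq X).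

Lemma tree_derived_sub T a : tree_derived T a `<=` T.
Proof.
elim: a => [//|a IH s [/IH//]|U u0 f IH s fs]; exact: (IH u0 _ (fs u0)).
Qed.

Lemma tree_derived_mono S T a : S `<=` T -> tree_derived S a `<=` tree_derived T a.
Proof.
move=> ST; elim: a => [//|a IH s [/IH Ts [t t0 /IH Tst]]|U u0 f IH s fs u].
  by split=> //; exists t.
exact: IH (fs u).
Qed.

Lemma tree_derived_anti T a b : ord_le a b ->
  tree_derived T b `<=` tree_derived T a.
Proof.
elim: a b => [|a IHa|U u0 f IH] b; first by move=> _; exact: tree_derived_sub.
  elim: b => [//|b _ /IHa ba|U u0 f IH [u /IH fa]]; last by move=> s fs; exact: fa (fs u).
  by move=> s [/ba ? [t t0 /ba ?]]; split=> //; exists t.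
by move=> fb s bs u; exact: (IH u b (fb u) s bs).
Qed.

(** This is why the product b * xi comes with b on the left: derivations of order
    b * (xi + 1) = b * xi + b are b derivations performed after b * xi ones. *)
Lemma tree_derived_add T a b :
  tree_derived T (ord_add a b) = tree_derived (tree_derived T a) b.
Proof.
elim: b => [//|b /= -> //|U u0 f IH /=].
by apply/seteqP; split=> s fs u; [rewrite -IH|rewrite IH]; exact: fs.
Qed.

Lemma tree_derived_shift T s a :
  [set t | tree_derived T a (s ++ t)] `<=` tree_derived [set t | T (s ++ t)] a.
Proof.
elim: a => [//|a IH t /= [st [w w0]]|U u0 f IH t /= fst u]; last exact: IH (fst u).
by rewrite -catA => stw; split; [exact: IH|exists w => //; exact: IH].
Qed.

(** [tree_order] is [XInfty] unless a least vanishing order exists, so a bound on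
    it must produce that least order, hence well-foundedness. *)
Lemma tree_order_le T a : tree_derived T a = set0 ->
  exists2 b, tree_order T = XFin b & ord_le b a.
Proof.
move=> Ta; rewrite /tree_order; case: pselect => [h|[]].
  case: (cid h) => b [Tb bmin] /=; exists b => //; exact: bmin.
have [b Tb bmin] := ord_least (P := fun a => tree_derived T a = set0) Ta.
by exists b; split.
Qed.

Lemma tree_order_eq0 T a b : tree_order T = XFin b -> ord_le b a ->
  tree_derived T a = set0.
Proof.
rewrite /tree_order; case: pselect => // h; case: (cid h) => c [Tc _] /= [<-] ca.
by rewrite -classical_sets.subset0 -Tc; exact: tree_derived_anti.
Qed.

End Trees.

Lemma xord_sup_fin (T : Type) (t0 : T) (f : T -> xordnum) a :
  xord_sup t0 f = XFin a -> forall t, exists2 b, f t = XFin b & ord_le b a.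
Proof.
rewrite /xord_sup; case: pselect => // nf [<-] t.
case ft: (f t) => [b|]; last by case: nf; exists t.
exists b => //; have := ord_le_refl (OSup t0 (fun t => if f t is XFin a then a else OZero)).
by move=> /(_ t); rewrite ft.
Qed.

Lemma xord_sup_le (T : Type) (t0 : T) (f : T -> xordnum) a :
  (forall t, exists2 b, f t = XFin b & ord_le b a) ->
  xord_le (xord_sup t0 f) (XFin a).
Proof.
move=> fa; rewrite /xord_sup; case: pselect => [[t ft]|_ t /=].
  by have [b] := fa t; rewrite ft.
by have [b ->] := fa t.
Qed.

(** * Combinations with prescribed l1 norm of the coefficients *)

Section Combinations.
Variables (K : numFieldType).

(** Abstracting from the coefficients, this makes the condition that defines [T1]
    a statement on the pairs (r, x), see [T1P]; passing to blocks of a sequence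
    is then an inclusion between such sets of pairs. *)
Definition l1_combination (X : lmodType K) (s : seq X) (r : K) (x : X) : Prop :=
  exists a : nat -> K, r = \sum_(i < size s) `|a i| /\
                       x = \sum_(i < size s) a i *: s`_i.

Section Lmod.
Variable X : lmodType K.
Implicit Types (s t : seq X).

Lemma l1_combination_ge0 s r x : l1_combination s r x -> 0 <= r.
Proof. by move=> [a [-> _]]; apply: sumr_ge0. Qed.

Lemma l1_combination0 s : l1_combination s 0 0.
Proof.
exists (fun=> 0); split; rewrite big1 // => i _; first by rewrite normr0.
by rewrite scale0r.
Qed.

Lemma l1_combinationZ s r x c :
  l1_combination s r x -> l1_combination s (`|c| * r) (c *: x).
Proof.
move=> [a [-> ->]]; exists (fun i => c * a i); rewrite mulr_sumr scaler_sumr.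
by split; apply: eq_bigr => i _; rewrite ?normrM ?scalerA.
Qed.

Lemma l1_combination_catP s t r x :
  l1_combination (s ++ t) r x <->
  exists r1 r2 x1 x2, [/\ r = r1 + r2, x = x1 + x2,
    l1_combination s r1 x1 & l1_combination t r2 x2].
Proof.
split.
  move=> [a [-> ->]]; rewrite size_cat !big_split_ord /=.
  do 4!eexists; split; [reflexivity|reflexivity| |].
    exists a; split=> //; apply: eq_bigr => i _.
    by rewrite nth_cat ltn_ord.
  exists (fun i => a (size s + i)%N); split=> //; apply: eq_bigr => i _.
  by rewrite nth_cat ltnNge leq_addr /= addKn.
move=> [_ [_ [_ [_ [-> -> [a [-> ->]] [b [-> ->]]]]]]].
exists (fun i => if (i < size s)%N then a i else b (i - size s)%N).
rewrite size_cat !big_split_ord /=; split; congr (_ + _); apply: eq_bigr => i _.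
- by rewrite ltn_ord.
- by rewrite ltnNge leq_addr /= addKn.
- by rewrite nth_cat ltn_ord.
- by rewrite nth_cat ltnNge leq_addr /= addKn.
Qed.

Lemma l1_combination_catl s t r x :
  l1_combination t r x -> l1_combination (s ++ t) r x.
Proof.
move=> tx; apply/l1_combination_catP; exists 0, r, 0, x; rewrite !add0r.
by split=> //; exact: l1_combination0.
Qed.

Lemma l1_combination1P v r x :
  l1_combination [:: v : X] r x <-> exists c, r = `|c| /\ x = c *: v.
Proof.
split=> [[a [-> ->]]|[c [-> ->]]].
  by exists (a 0%N); rewrite !big_ord1.
by exists (fun=> c); rewrite !big_ord1.
Qed.

End Lmod.

Variables (X Y : normedModType K).

Lemma T1P (A : {linear X -> Y}) c s : T1 A c s <->
  all (fun v => `|v| <= 1) s /\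
  forall r x, l1_combination s r x -> `|x| <= r /\ r <= c * `|A x|.
Proof.
have AE (a : nat -> K) :
    A (\sum_(i < size s) a i *: s`_i) = \sum_(i < size s) a i *: A s`_i.
  by rewrite linear_sum; apply: eq_bigr => i _; rewrite linearZ.
split=> -[s1 sc]; split=> //.
  by move=> _ _ [a [-> ->]]; rewrite AE; exact: sc.
by move=> a; rewrite -AE; apply: sc; exists a.
Qed.

(** If every l1-normalized combination of every continuation of [s] had an image
    of norm at least [eps], then [B] would satisfy a lower l1 estimate with
    constant 1/eps on all of them. They would form a subtree of a [T1 B d], which
    however does not survive [b] derivations. *)
Lemma small_combination (A B : {linear X -> Y}) c b (S : set (seq X)) s eps :
  (forall d, 1 <= d -> tree_derived (T1 B d) b = set0) ->
  S `<=` T1 A c -> tree_derived S b s -> 0 < eps ->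
  exists t x, [/\ S (s ++ t), l1_combination t 1 x & `|B x| < eps].
Proof.
move=> B0 SA Ss eps0; apply: contrapT => nsmall.
(* The lower l1 estimate comes with 1 / eps; adding 1 makes it an admissible
   constant of the trees [T1]. *)
have d1 : 1 <= 1 + eps^-1 by rewrite lerDl invr_ge0 ltW.
suff sub : [set t | S (s ++ t)] `<=` T1 B (1 + eps^-1).
  suff : tree_derived (T1 B (1 + eps^-1)) b [::] by rewrite B0.
  apply: (tree_derived_mono sub); apply: tree_derived_shift.
  by rewrite /= cats0.
move=> t /= Sst; have /T1P[] := SA _ Sst.
rewrite all_cat => /andP[_ t1] stc; apply/T1P; split=> // r x tx.
have [xr _] := stc _ _ (l1_combination_catl s tx); split=> //.
have r_ge0 := l1_combination_ge0 tx.
have [->|r0] := eqVneq r 0; first by rewrite mulr_ge0 // (le_trans ler01).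
have rgt0 : 0 < r by rewrite lt_def r0.
have epsB : eps <= `|B (r^-1 *: x)|.
  rewrite real_leNgt ?normr_real ?gtr0_real //; apply/negP => Bx.
  apply: nsmall; exists t, (r^-1 *: x); split=> //.
  by rewrite -(mulVf r0) -[X in X * _]gtr0_norm ?invr_gt0 //; exact: l1_combinationZ.
move: epsB; rewrite linearZ normrZ gtr0_norm ?invr_gt0 // ler_pdivlMl // => rB.
rewrite mulrDl mul1r (@le_trans _ _ (eps^-1 * `|B x|)) ?lerDr //.
by rewrite ler_pdivlMl // mulrC.
Qed.

End Combinations.

(** * Norms in direct sums *)

Local Arguments dsum_sums {K I E e U} u t _.

Section DirectSumTheory.
Variables (K : numFieldType) (I : choiceType) (E : completeNormedModType K).
Variables (e : unc1_basis I E) (U : I -> completeNormedModType K).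

Lemma sums_to_sum n (x : nat -> I -> E) l : (forall k, sums_to (x k) (l k)) ->
  sums_to (fun i => \sum_(k < n) x k i) (\sum_(k < n) l k).
Proof.
move=> xl; elim: n => [|n IH].
  rewrite big_ord0; under eq_fun do rewrite big_ord0.
  by apply: cvg_near_cst; near=> S; rewrite /partial_sum big1.
rewrite big_ord_recr; under eq_fun do rewrite big_ord_recr.
exact: sums_toD.
Unshelve. all: by end_near. Qed.

Lemma dsum_sumE n (u : 'I_n -> dsum e U) i :
  (\sum_(k < n) u k : dsum e U) i = \sum_(k < n) u k i.
Proof. by elim/big_rec2: _ => [//|k x y _ <-]. Qed.

Lemma dsum_norm_sums (u : dsum e U) x :
  sums_to (fun i => `|u i| *: e i) x -> `|u| = `|x|.
Proof. by move=> ux; rewrite dsum_normE; congr (`|_|); exact/cvg_lim. Qed.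

Lemma dsum_norm_le (u : dsum e U) (b : I -> K) y :
  (forall i, `|u i| <= `|b i|) -> sums_to (fun i => b i *: e i) y -> `|u| <= `|y|.
Proof.
move=> ub bY; rewrite dsum_normE; apply: (dominated_le _ bY (dsum_sums u)) => i.
by rewrite normr_id.
Qed.

Lemma dsum_part_le (u : dsum e U) (S : {fset I}) :
  `|\sum_(i <- S) `|u i| *: e i| <= `|u|.
Proof.
rewrite [leRHS]dsum_normE.
have -> : \sum_(i <- S) `|u i| *: e i =
    \sum_(i <- S) (if i \in S then `|u i| else 0) *: e i.
  by apply: eq_big_seq => i ->.
apply: (dominated_le _ (dsum_sums u) (sums_finite _)).
  by move=> i; case: ifP; rewrite ?normr0.
by move=> i /negbTE ->.
Qed.

(** Finitely supported elements are dense in the direct sum; the family [v] stands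
    for the restriction of [u] to the complement of [S]. *)
Lemma dsum_tail (u : dsum e U) eps : 0 < eps ->
  exists S0 : {fset I}, forall (S : {fset I}) (v : dsum e U), (S0 `<=` S)%fset ->
    (forall i, v i = if i \in S then 0 else u i) -> `|v| < eps.
Proof.
move=> eps0; have /cvgrPdist_lt/(_ _ eps0)[S0 _ HS0] := dsum_sums u.
exists S0 => S v S0S vE.
have /(_ S0S) /= := HS0 S; rewrite partial_sumE => uS.
rewrite (dsum_norm_sums (x := lim (partial_sum (fun i => `|u i| *: e i) @ totally) -
  \sum_(i <- S) `|u i| *: e i)) //.
have := sums_toD (dsum_sums u) (@sums_finite _ _ _ e
  (fun i => if i \in S then - `|u i| else 0) S _).
rewrite (_ : (fun i => _ + _) = fun i => `|v i| *: e i); last first.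
  apply/funext => i; rewrite -scalerDl vE.
  by case: ifP => _; rewrite ?subrr ?normr0 ?addr0.
have -> : \sum_(i <- S) (if i \in S then - `|u i| else 0) *: e i =
    - \sum_(i <- S) `|u i| *: e i.
  by rewrite -sumrN; apply: eq_big_seq => i ->; rewrite scaleNr.
by apply=> i /negbTE ->.
Qed.

End DirectSumTheory.

(** * Almost disjoint blocks *)

Section Blocks.
Variables (R : realType) (K : numFieldType) (hK : scalar_field R K).
Variables (I : choiceType) (E F : completeNormedModType K).
Variables (e : unc1_basis I E) (f : unc1_basis I F).
Variables (U V : I -> completeNormedModType K).
Variables (A_ : forall i, {linear U i -> V i}) (hA : maps_dsum e f A_).
Hypothesis A_bounded : forall i, bounded_near (A_ i) (nbhs 0).
Variable I_EF : {linear E -> F}.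
Hypothesis I_EF_basis : forall i, I_EF (e i) = opnorm (A_ i) *: f i.

Let A : {linear dsum e U -> dsum f V} := dsum_op hA.
Let A_J (J : {fset I}) : {linear dsum e U -> dsum f V} :=
  dsum_op (maps_dsum_restrict [set` J] hA).

Implicit Types (ps : seq (dsum e U * {fset I})) (s : seq (dsum e U)).

Definition block_vector (p : dsum e U * {fset I}) : E :=
  \sum_(i <- p.2) `|p.1 i| *: e i.

Definition almost_disjoint_blocks (eps : K) ps : Prop :=
  pairwise (fun p q => [disjoint p.2 & q.2]%fset) ps /\
  all (fun p => (`|p.1| <= 1) && (`|A p.1 - A_J p.2 p.1| <= eps)) ps.

Lemma A_JE J x i : A_J J x i = if i \in J then A_ i (x i) else 0.
Proof.
rewrite /= indicE mem_setE; case: (i \in J); first by rewrite scale1r.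
by rewrite scale0r.
Qed.

(** At each index [i] at most one block contributes, so the coordinates can be
    compared one block at a time, where |A_i x(i)| <= |A_i| |x(i)|;
    1-unconditionality of [f] turns this into the inequality of norms. *)
Lemma block_le ps (b : nat -> K) :
  let p := nth (0, fset0) ps in
  pairwise (fun p q => [disjoint p.2 & q.2]%fset) ps ->
  `|\sum_(k < size ps) b k *: A_J (p k).2 (p k).1| <=
  `|\sum_(k < size ps) b k *: I_EF (block_vector (p k))|.
Proof.
move=> p /(pairwiseP (0, fset0)) dis.
pose a k i := b k * (if i \in (p k).2 then `|(p k).1 i| * opnorm (A_ i) else 0).
have IE k : sums_to (fun i => a k i *: f i) (b k *: I_EF (block_vector (p k))).
  under eq_fun do rewrite -scalerA; apply: sums_toZ.
  have -> : I_EF (block_vector (p k)) = \sum_(i <- (p k).2)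
      (if i \in (p k).2 then `|(p k).1 i| * opnorm (A_ i) else 0) *: f i.
    rewrite linear_sum; apply: eq_big_seq => i ->.
    by rewrite linearZ /= I_EF_basis scalerA.
  by apply: sums_finite => i /negbTE ->.
apply: dsum_norm_le; last first.
  have := @sums_to_sum _ _ _ (size ps) _ _ IE.
  by under eq_fun do rewrite -scaler_suml; exact.
move=> i; rewrite dsum_sumE.
have -> : \sum_(k < size ps) (b k *: A_J (p k).2 (p k).1) i =
    \sum_(k < size ps) b k *: (if i \in (p k).2 then A_ i ((p k).1 i) else 0).
  by apply: eq_bigr => k _; rewrite -A_JE.
have [[k ik]|nk] := pselect (exists k : 'I_(size ps), i \in (p k).2); last first.
  rewrite big1 ?normr0 // => k _.
  by case: ifP => [ik|]; rewrite ?scaler0 //; case: nk; exists k.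
have off (l : 'I_(size ps)) : l != k -> (i \in (p l).2) = false.
  move=> lk; apply/negP => il.
  have [|kl|/val_inj lkE] := ltngtP l k; last by rewrite lkE eqxx in lk.
    by move=> /(dis l k (ltn_ord _) (ltn_ord _))/fdisjointP/(_ i il)/negP; exact.
  by have /fdisjointP/(_ i ik)/negP := dis k l (ltn_ord _) (ltn_ord _) kl; exact.
rewrite (bigD1 k) // [X in `|_ + X|]big1 /=; last first.
  by move=> l /off ->; rewrite scaler0.
rewrite [X in _ <= `|X|](bigD1 k) // [X in _ <= `|_ + X|]big1 /=; last first.
  by move=> l /off il; rewrite /a il mulr0.
rewrite !addr0 /a ik normrZ normrM ler_wpM2l //.
have Ai := opnorm_le ((p k).1 i) hK (A_bounded i).
by rewrite mulrC ger0_norm // (le_trans _ Ai).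
Qed.

(** With r the sum of the |b_k|, the lower estimate for [A] and [block_le] give
    r <= c (N + r / (2c)), where N is the norm of the combination of the images of
    the block vectors. Hence r <= 2 c N. *)
Lemma block_vectors_T1 c ps s : 1 <= c ->
  almost_disjoint_blocks (2 * c)^-1 ps ->
  (forall r x, l1_combination [seq p.1 | p <- ps] r x -> l1_combination s r x) ->
  T1 A c s -> T1 I_EF (2 * c) [seq block_vector p | p <- ps].
Proof.
move=> c1 [dis /(all_nthP (0, fset0)) psb] comb /T1P[_ sc].
have c0 : 0 < c by rewrite (lt_le_trans ltr01).
pose p := nth (0, fset0) ps.
have z1 k : (k < size ps)%N -> `|block_vector (p k)| <= 1.
  by move=> /psb/andP[x1 _]; exact: le_trans (dsum_part_le _ _) x1.
split.
  by rewrite all_map; apply/(all_nthP (0, fset0)) => k kn; exact: z1.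
move=> b; rewrite size_map.
have -> : \sum_(i < size ps) b i *: [seq block_vector p | p <- ps]`_i =
    \sum_(i < size ps) b i *: block_vector (p i).
  by apply: eq_bigr => i _; rewrite (nth_map (0, fset0)).
have -> : \sum_(i < size ps) b i *: I_EF [seq block_vector p | p <- ps]`_i =
    \sum_(i < size ps) b i *: I_EF (block_vector (p i)).
  by apply: eq_bigr => i _; rewrite (nth_map (0, fset0)).
split.
  apply: le_trans (ler_norm_sum _ _ _) _; apply: ler_sum => k _.
  by rewrite normrZ -[leRHS]mulr1 ler_wpM2l // z1.
set r := \sum_(i < _) `|b i|.
have [_] : `|\sum_(k < size ps) b k *: (p k).1| <= r /\
    r <= c * `|A (\sum_(k < size ps) b k *: (p k).1)|.
  apply: sc; apply: comb; exists b; rewrite size_map; split=> //.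
  by apply: eq_bigr => i _; rewrite (nth_map (0, fset0)).
have AE : A (\sum_(k < size ps) b k *: (p k).1) =
    \sum_(k < size ps) b k *: A_J (p k).2 (p k).1 +
    \sum_(k < size ps) b k *: (A (p k).1 - A_J (p k).2 (p k).1).
  rewrite -big_split linear_sum; apply: eq_bigr => k _.
  by rewrite linearZ [RHS]addrC scalerBr subrK.
have tail : `|\sum_(k < size ps) b k *: (A (p k).1 - A_J (p k).2 (p k).1)| <=
    r * (2 * c)^-1.
  rewrite mulr_suml; apply: le_trans (ler_norm_sum _ _ _) _.
  apply: ler_sum => k _; rewrite normrZ ler_wpM2l //.
  by have /andP[] := psb k (ltn_ord k).
rewrite AE => rA.
have {rA} : r <= c * `|\sum_(k < size ps) b k *: I_EF (block_vector (p k))| + r / 2.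
  apply: (le_trans rA).
  have -> : r / 2 = c * (r * (2 * c)^-1).
    by rewrite invfM mulrCA [c * _]mulrC mulfVK ?gt_eqF //.
  rewrite -mulrDr ler_wpM2l ?(ltW c0) //.
  by apply: le_trans (ler_normD _ _) _; apply: lerD tail; exact: block_le.
rewrite -lerBlDr [X in X - _]splitr addrK ler_pdivrMr // => rI.
by rewrite -mulrA mulrC.
Qed.

(** One takes for [J] the union of the sets already used, and for [B] the set
    S \ J, where [S] contains [J] and nearly all of the mass of A x. The error
    A x - A_B x is the part of A x outside [S] plus A_J x. *)
Lemma blocks_extend eps ps : 0 < eps -> almost_disjoint_blocks eps ps ->
  exists J : {fset I}, forall x : dsum e U, `|x| <= 1 -> `|A_J J x| < eps / 2 ->
    exists B, almost_disjoint_blocks eps (rcons ps (x, B)).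
Proof.
move=> eps0 [dis psb].
have [J JP] : exists J : {fset I}, all (fun p => (p.2 `<=` J)%fset) ps.
  elim: (ps) => [|p qs [J JP]]; first by exists fset0.
  exists (p.2 `|` J)%fset; rewrite /= fsubsetUl /=.
  by apply: sub_all JP => q /fsubset_trans; apply; exact: fsubsetUr.
have eps20 : 0 < eps / 2 by rewrite divr_gt0.
exists J => x x1 xJ; have [S0 S0P] := dsum_tail (A x) eps20.
pose S := (S0 `|` J)%fset.
exists (S `\` J)%fset; split.
  rewrite pairwise_rcons dis andbT; apply: sub_all JP => p /= /fsubsetP pJ.
  by apply/fdisjointP => i /pJ iJ; rewrite inE iJ.
rewrite all_rcons psb andbT /= x1 /=.
have -> : A x - A_J (S `\` J)%fset x = (A x - A_J S x) + A_J J x.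
  apply: dsum_ext => i.
  rewrite [LHS](_ : _ = A_ i (x i) - A_J (S `\` J)%fset x i) //.
  rewrite [RHS](_ : _ = A_ i (x i) - A_J S x i + A_J J x i) // !A_JE !inE.
  by case: (i \in J); rewrite ?orbT ?orbF /= ?subr0 ?subrr ?add0r ?addr0.
apply: le_trans (ler_normD _ _) _; rewrite [leRHS]splitr lerD // ltW //.
apply: (S0P S); first exact: fsubsetUl.
move=> i; rewrite [LHS](_ : _ = A_ i (x i) - A_J S x i) // A_JE.
by case: ifP; rewrite ?subrr ?subr0.
Qed.

(** Each batch of b derivations of T1(A, c) pays for one more block, hence for one
    derivation of T1(I_EF, 2c). The statement covers all [ps] and [s] at once since
    the successor step applies it to the extended sequences. *)
Lemma block_tree c b xi ps s : 1 <= c ->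
  (forall J d, 1 <= d -> tree_derived (T1 (A_J J) d) b = set0) ->
  almost_disjoint_blocks (2 * c)^-1 ps ->
  (forall r x, l1_combination [seq p.1 | p <- ps] r x -> l1_combination s r x) ->
  tree_derived (T1 A c) (ord_mul b xi) s ->
  tree_derived (T1 I_EF (2 * c)) xi [seq block_vector p | p <- ps].
Proof.
move=> c1 Ab; have eps0 : 0 < (2 * c)^-1.
  by rewrite invr_gt0 mulr_gt0 // (lt_le_trans ltr01).
elim: xi ps s => [|xi IH|T t0 g IH] ps s psP comb /= sT; last first.
- by move=> t; exact: IH psP comb (sT t).
- move: sT; rewrite tree_derived_add => sT.
  split; first exact: IH psP comb (tree_derived_sub sT).
  have [J JP] := blocks_extend eps0 psP.
  have [t [x [st tx Jx]]] := small_combination (Ab J)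
    (@tree_derived_sub _ _ _) sT (divr_gt0 eps0 (ltr0Sn K 1)).
  have /T1P[_ /(_ _ _ (l1_combination_catl s tx))[x1 _]] := tree_derived_sub st.
  have [B BP] := JP _ x1 Jx.
  exists [:: block_vector (x, B)] => //.
  rewrite cats1 -map_rcons; apply: IH BP _ st => r y.
  rewrite map_rcons -cats1 => /l1_combination_catP[r1 [r2 [y1 [y2 [-> ->]]]]].
  move=> /comb sy1 /l1_combination1P[a [-> ->]].
  apply/l1_combination_catP; do 4!eexists; split; [reflexivity..|exact: sy1|].
  by rewrite -(mulr1 `|a|); exact: l1_combinationZ.
- exact: block_vectors_T1 psP comb sT.
Qed.

End Blocks.

(** * The index of a diagonal operator *)

Theorem proposition6p7 (R : realType) (K : numFieldType)
    (hK : scalar_field R K) (I : choiceType) (E F : completeNormedModType K)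
    (e : unc1_basis I E) (f : unc1_basis I F)
    (U V : I -> completeNormedModType K)
    (A_ : forall i, {linear U i -> V i})
    (A_bounded : forall i, bounded_near (A_ i) (nbhs 0))
    (I_EF : {linear E -> F})
    (I_EF_bounded : bounded_near I_EF (nbhs 0))
    (I_EF_basis : forall i, I_EF (e i) = opnorm (A_ i) *: f i) :
  let hA : maps_dsum e f A_ := maps_dsumP hK A_bounded I_EF_bounded I_EF_basis in
  let A : {linear dsum e U -> dsum f V} := dsum_op hA in
  let A_J (J : set I) : {linear dsum e U -> dsum f V} :=
    dsum_op (maps_dsum_restrict J hA) in
  xord_le (NP1 A)
    (xord_mul (xord_sup (fset0 : {fset I}) (fun J => NP1 (A_J [set` J])))
              (NP1 I_EF)).
Proof.
move=> hA A A_J.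
(* A product with an infinite factor is infinite and bounds everything. *)
case AJ: (xord_sup _ _) => [b|]; last by case: (NP1 A).
case NI: (NP1 I_EF) => [g|]; last by case: (NP1 A).
apply: xord_sup_le => -[c c1]; apply: tree_order_le.
have AJ0 (J : {fset I}) d : 1 <= d -> tree_derived (T1 (A_J [set` J]) d) b = set0.
  move=> d1; have [bJ bJE bJb] := xord_sup_fin AJ J.
  have [a aE abJ] := xord_sup_fin bJE (exist _ d d1).
  exact: tree_order_eq0 aE (ord_le_trans abJ bJb).
have c21 : 1 <= 2 * c by rewrite (le_trans c1) // ler_peMl ?ler1n // (le_trans ler01).
have [a aE ag] := xord_sup_fin NI (exist _ (2 * c) c21).
have I0 := tree_order_eq0 aE ag.
rewrite -classical_sets.subset0 => s sT.
have nilT := is_tree_derived (T1_is_tree (A := A) (c := c)) (s := [::]) sT.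
have : tree_derived (T1 I_EF (2 * c)) g [::]; last by rewrite I0.
exact: (block_tree hK A_bounded I_EF_basis c1 AJ0 (ps := [::]) _ _ nilT).
Qed.
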